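(* Let $(X,G)$ be a compact $G$-space. (i) If every group $*$-closed in $X$ is solvable-by-finite, then every ring with identity or of finite characteristic which is $*$-closed in $X$ is nilpotent-by-finite. Likewise, if every group $*$-closed in $X^{teq}$ is solvable-by-finite, then every ring with identity or of finite characteristic which is $*$-closed in $X^{teq}$ is nilpotent-by-finite. (ii) If every nilpotent group $*$-closed in $X$ is abelian-by-finite, then every ring $*$-closed in $X$ is null-by-finite. Likewise, if every nilpotent group $*$-closed in $X^{teq}$ is abelian-by-finite, then every ring $*$-closed in $X^{teq}$ is null-by-finite.
   Context: A compact $G$-space is a pair $(X,G)$ where $X$ is a compact Hausdorff space and $G$ is a Polish group acting faithfully and continuously on $X$ (stabilizers of points being closed). For a finite $A\subseteq X$, $G_A$ denotes the pointwise stabilizer of $A$; a subset $D\subseteq X^n$ is $A$-closed if it is closed and $G_A$-invariant, and $*$-closed if it is $A$-closed for some finite $A$. $X^{teq}$ is the disjoint union of the spaces $X^n/E$ (with quotient topology and induced $G$-action), where $E$ ranges over all $\emptyset$-closed equivalence relations on $X^n$, $n\ge1$; $*$-closed subsets of products of such sorts are defined analogously. A group (ring) is $*$-closed in $X$ [in $X^{teq}$] if its universe and the graphs of its operations (group operation; resp. addition and multiplication) are $*$-closed in $X$ [in $X^{teq}$]. Rings are associative, not necessarily with $1$ or commutative. A group is abelian-by-finite [solvable-by-finite] if it has a normal abelian [solvable] subgroup of finite index; a ring is null-by-finite [nilpotent-by-finite] if it has an ideal $I$ of finite index with $I\cdot I=\{0\}$ [with $I$ nilpotent]. *)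

(* Defs.v *)
From HB Require Import structures.
From mathcomp Require Import all_boot all_order all_algebra generic_quotient.
From mathcomp Require Import all_classical all_reals all_analysis.

Set Implicit Arguments.
Unset Strict Implicit.
Unset Printing Implicit Defensive.

Local Open Scope classical_set_scope.

(* Associative rings, not necessarily commutative or with 1. *)
HB.mixin Record Zmodule_isNonUnitalRing R & GRing.Zmodule R := {
  numul : R -> R -> R;
  numulA : associative numul;
  numulDl : left_distributive numul +%R;
  numulDr : right_distributive numul +%R
}.

#[short(type="nonUnitalRingType")]
HB.structure Definition NonUnitalRing :=
  {R of GRing.Zmodule R & Zmodule_isNonUnitalRing R}.

HB.mixin Record isTopGroup G & Group G & Topological G := {
  mulg_continuous : continuous (fun p : G * G => (p.1 * p.2)%g);
  invg_continuous : continuous (fun x : G => (x^-1)%g)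
}.

#[short(type="topGroupType")]
HB.structure Definition TopGroup :=
  {G of Group G & Topological G & isTopGroup G}.

Section Groups.
Local Open Scope group_scope.
Variable H : groupType.
Implicit Types A B N : set H.

Definition subgroup N :=
  [/\ N 1, (forall x y, N x -> N y -> N (x * y)) &
      (forall x, N x -> N x^-1)].

Definition normal_subgroup N :=
  subgroup N /\ (forall x y, N x -> N (x ^ y)).

Definition finite_index N :=
  finite_set [set [set x * h | h in N] | x in [set: H]].

Definition abelian_subset N := forall x y, N x -> N y -> x * y = y * x.

(* The commutator subgroup [A, B], generated by the [~ a, b]. *)
Definition commutator A B : set H :=
  smallest subgroup [set [~ a, b] | a in A & b in B].

Definition solvable_subset N :=
  exists n, iter n (fun A => commutator A A) N = [set 1].

Definition nilpotent_group :=
  exists n, iter n (fun A => commutator A [set: H]) [set: H] = [set 1].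

Definition abelian_by_finite :=
  exists N, [/\ normal_subgroup N, abelian_subset N & finite_index N].

Definition solvable_by_finite :=
  exists N, [/\ normal_subgroup N, solvable_subset N & finite_index N].
End Groups.

Section Rings.
Local Open Scope ring_scope.
Variable R : nonUnitalRingType.
Implicit Types I J : set R.

Definition additive_subgroup I :=
  [/\ I 0, (forall x y, I x -> I y -> I (x + y)) & (forall x, I x -> I (- x))].

Definition ideal I :=
  additive_subgroup I /\
  (forall r x, I x -> I (numul r x) /\ I (numul x r)).

Definition finite_index_ideal I :=
  finite_set [set [set x + h | h in I] | x in [set: R]].

(* The product I . J of ideals: the finite sums of products. *)
Definition ideal_mul I J : set R :=
  smallest additive_subgroup [set numul x y | x in I & y in J].

(* The n-th iterate below is the power I^(n+1). *)
Definition nilpotent_ideal I :=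
  exists n, iter n (fun J => ideal_mul J I) I = [set 0].

Definition null_by_finite :=
  exists I, [/\ ideal I, ideal_mul I I = [set 0] & finite_index_ideal I].

Definition nilpotent_by_finite :=
  exists I, [/\ ideal I, nilpotent_ideal I & finite_index_ideal I].

Definition has_identity :=
  exists e : R, forall x, numul e x = x /\ numul x e = x.

Definition finite_characteristic :=
  exists2 n, (0 < n)%N & forall x : R, x *+ n = 0.
End Rings.

Definition separable_space (T : topologicalType) :=
  exists2 D : set T, countable D & dense D.

Definition completely_metrizable (R : realType) (T : topologicalType) :=
  exists (M : metricType R) (f : T -> M) (g : M -> T),
    [/\ cancel f g, cancel g f, continuous f, continuous g &
        forall F : set_system M, ProperFilter F -> cauchy F ->
          exists x : M, F --> x].

Definition polish (R : realType) (T : topologicalType) :=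
  separable_space T /\ completely_metrizable R T.

Record compact_G_space (R : realType) (X : topologicalType) (G : topGroupType)
    (act : G -> X -> X) : Prop := CompactGSpace {
  cgs_polish : polish R G;
  cgs_compact : compact [set: X];
  cgs_hausdorff : hausdorff_space X;
  cgs_act1 : forall x, act 1%g x = x;
  cgs_actM : forall g h x, act (g * h)%g x = act g (act h x);
  cgs_continuous : continuous (fun p : G * X => act p.1 p.2);
  cgs_faithful : forall g, (forall x, act g x = x) -> g = 1%g;
  (* implied by the other fields *)
  cgs_stab_closed : forall x, closed [set g | act g x = x]
}.

(* Below [Y] is the universe the parameters are taken from and [S] the space in
   which the set [D] lives. *)
Section StarClosed.
Variables (G : topGroupType) (Y : Type) (actY : G -> Y -> Y).

Definition pointwise_stabilizer (A : set Y) : set G :=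
  [set g | forall a, A a -> actY g a = a].

Definition closed_over (A : set Y) (S : topologicalType) (actS : G -> S -> S)
    (D : set S) :=
  closed D /\
  (forall g x, pointwise_stabilizer A g -> D x -> D (actS g x)).

Definition star_closed (S : topologicalType) (actS : G -> S -> S)
    (D : set S) :=
  exists2 A : set Y, finite_set A & closed_over A actS D.

Definition diag2 (S : Type) (actS : G -> S -> S) (g : G) (p : S * S) : S * S :=
  (actS g p.1, actS g p.2).

Definition diag3 (S : Type) (actS : G -> S -> S) (g : G) (p : S * S * S)
    : S * S * S :=
  (actS g p.1.1, actS g p.1.2, actS g p.2).

(* The graph of the operation [op] on [T], where [u] identifies [T] with a
   subset of [S]. *)
Definition op_graph (T S : Type) (u : T -> S) (op : T -> T -> T)
    : set (S * S * S) :=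
  [set p | exists x y, p = (u x, u y, u (op x y))].

Definition star_closed_group_in (S : topologicalType) (actS : G -> S -> S)
    (H : groupType) (u : H -> S) :=
  [/\ injective u,
      star_closed actS (range u) &
      star_closed (diag3 actS) (op_graph u (fun x y => (x * y)%g))].

Definition star_closed_ring_in (S : topologicalType) (actS : G -> S -> S)
    (R : nonUnitalRingType) (u : R -> S) :=
  [/\ injective u,
      star_closed actS (range u),
      star_closed (diag3 actS) (op_graph u +%R) &
      star_closed (diag3 actS) (op_graph u numul)].
End StarClosed.

Section InX.
Variables (G : topGroupType) (X : topologicalType) (act : G -> X -> X).

Definition pow_space (n : nat) : topologicalType := {ptws 'I_n -> X}.

Definition pow_act (n : nat) (g : G) (x : pow_space n) : pow_space n :=
  fun i => act g (x i).

Definition star_closed_group (H : groupType) :=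
  exists (n : nat) (u : H -> pow_space n),
    star_closed_group_in act (@pow_act n) u.

Definition star_closed_ring (R : nonUnitalRingType) :=
  exists (n : nat) (u : R -> pow_space n),
    star_closed_ring_in act (@pow_act n) u.

Record teq_sort := TeqSort {
  sort_arity : nat;
  sort_arity_gt0 : (0 < sort_arity)%N;
  sort_rel : equiv_rel (pow_space sort_arity);
  sort_rel_closed : closed_over act set0 (diag2 (@pow_act sort_arity))
    [set p : pow_space sort_arity * pow_space sort_arity | sort_rel p.1 p.2]
}.

Definition sort_space (s : teq_sort) : topologicalType :=
  quotient_topology {eq_quot (sort_rel s)}%qT.

(* Independent of the representative, by invariance of the relation. *)
Definition sort_act (s : teq_sort) (g : G) (q : sort_space s) : sort_space s :=
  (\pi_(sort_space s) (pow_act g (repr q)))%qT.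

Definition teq : Type := {s : teq_sort & sort_space s}.

Definition teq_act (g : G) (a : teq) : teq :=
  Tagged sort_space (sort_act g (tagged a)).

Definition sort_prod (k : nat) (s : 'I_k -> teq_sort) : topologicalType :=
  prod_topology (fun i => sort_space (s i)).

Definition sort_prod_act (k : nat) (s : 'I_k -> teq_sort) (g : G)
    (x : sort_prod s) : sort_prod s :=
  fun i => sort_act g (x i).

Definition teq_star_closed_group (H : groupType) :=
  exists (k : nat) (s : 'I_k -> teq_sort) (u : H -> sort_prod s),
    star_closed_group_in teq_act (@sort_prod_act k s) u.

Definition teq_star_closed_ring (R : nonUnitalRingType) :=
  exists (k : nat) (s : 'I_k -> teq_sort) (u : R -> sort_prod s),
    star_closed_ring_in teq_act (@sort_prod_act k s) u.
End InX.

(* Main.v *)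
Require Import Defs.
From HB Require Import structures.
From mathcomp Require Import all_boot all_order all_algebra generic_quotient.
From mathcomp Require Import all_classical all_reals all_analysis.

(** Let [K] be a *-closed ring, encoded in a compact space [S]. The relations on
    [K] whose images in the powers of [S] are *-closed are stable under finite
    intersections, substitution of variables and, by compactness, projections;
    so they comprise the graphs of the polynomial functions. Hence a group of
    matrices over [K] given by polynomial equations, possibly with auxiliary
    unknowns, is *-closed. No continuity of the operations, and no separation of
    the quotient sorts, is needed for this.

    (i) Take the group of the [3 x 3] matrices over [K] that are invertible for
    [M o N = M + N + M N] (i.e. the [1 + M] in [GL_3], which makes sense without
    an identity), and a normal solvable subgroup [N] of finite index. Since
    [[e_ij(a), e_jk(b)] = e_ik(a b)], the [a] all of whose elementary matrices
    lie in [N] form a subring of finite index, in which the products of [2 ^ n]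
    elements vanish if [N] has derived length [n].

    (ii) Take the Heisenberg group over [K] and an abelian subgroup [N] of
    finite index. The [x] with [(x, 0, 0)] and [(0, x, 0)] in [N] form a subring
    of finite index with zero multiplication.

    In both cases, by Lewin's theorem, a subring of finite index contains an
    ideal of finite index. *)

Set Implicit Arguments.
Unset Strict Implicit.
Unset Printing Implicit Defensive.

Import GRing.Theory.
Local Open Scope classical_set_scope.
Local Open Scope ring_scope.

(** * Subrings of finite index *)

Section NonUnitalRingTheory.
Variable K : nonUnitalRingType.
Implicit Types (a x y z : K) (A B I J : set K).

Definition rnumul a x := numul x a.

Fact numul_zmod_morphism a : zmod_morphism (numul a).
Proof. by move=> x y; apply: (canRL (addrK _)); rewrite -numulDr subrK. Qed.

Fact rnumul_zmod_morphism a : zmod_morphism (rnumul a).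
Proof. by move=> x y; apply: (canRL (addrK _)); rewrite -numulDl subrK. Qed.

HB.instance Definition _ a :=
  GRing.isZmodMorphism.Build K K (numul a) (numul_zmod_morphism a).
HB.instance Definition _ a :=
  GRing.isZmodMorphism.Build K K (rnumul a) (rnumul_zmod_morphism a).

Lemma numulr0 x : numul x 0 = 0. Proof. exact: (raddf0 (numul x)). Qed.

Lemma numul0r x : numul 0 x = 0. Proof. exact: (raddf0 (rnumul x)). Qed.

Lemma numulrN x y : numul x (- y) = - numul x y.
Proof. exact: (raddfN (numul x)). Qed.

Lemma numulNr x y : numul (- x) y = - numul x y.
Proof. exact: (raddfN (rnumul y)). Qed.

Lemma numul_sumr (I : Type) (r : seq I) (F : I -> K) x :
  numul x (\sum_(i <- r) F i) = \sum_(i <- r) numul x (F i).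
Proof. exact: (raddf_sum (numul x)). Qed.

Lemma numul_suml (I : Type) (r : seq I) (F : I -> K) x :
  numul (\sum_(i <- r) F i) x = \sum_(i <- r) numul (F i) x.
Proof. exact: (raddf_sum (rnumul x)). Qed.

Lemma additive_subgroup0 : additive_subgroup [set 0 : K].
Proof. by split=> [//|_ _ -> ->|_ ->]; rewrite /= ?addr0 ?oppr0. Qed.

Lemma additive_subgroup_bigcap (I : Type) (D : set I) (A : I -> set K) :
  (forall i, D i -> additive_subgroup (A i)) ->
  additive_subgroup (\bigcap_(i in D) A i).
Proof.
move=> sgA; split=> [i /sgA[]//|x y Ax Ay i Di|x Ax i Di].
  by have [_ AD _] := sgA i Di; apply: AD; [exact: Ax|exact: Ay].
by have [_ _ AN] := sgA i Di; apply/AN/Ax.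
Qed.

Lemma additive_subgroup_preimage A (f : {additive K -> K}) :
  additive_subgroup A -> additive_subgroup (f @^-1` A).
Proof.
move=> [A0 AD AN]; split=> [|x y fx fy|x fx] /=; first by rewrite raddf0.
  by rewrite raddfD; apply: AD.
by rewrite raddfN; apply: AN.
Qed.

Definition add_coset A x : set K := [set x + h | h in A].

Definition finite_index_subgroup A :=
  additive_subgroup A /\ finite_index_ideal A.

Lemma add_coset_eq A x y :
  additive_subgroup A -> add_coset A x = add_coset A y -> A (x - y).
Proof.
move=> [A0 _ _] eqxy.
have : add_coset A x x by exists 0; rewrite ?addr0.
by rewrite eqxy => -[h Ah <-]; rewrite addrC addKr.
Qed.

Lemma finite_index_ideal_fibers A (T : Type) (c : K -> T) :
    additive_subgroup A -> finite_set (range c) ->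
  (forall x y, c x = c y -> A (x - y)) -> finite_index_ideal A.
Proof.
move=> sgA finc cA; have [_ AD _] := sgA.
pose fiber_coset t := [set x | exists2 y, c y = t & A (x - y)].
rewrite /finite_index_ideal -/(add_coset A).
rewrite (_ : add_coset A = fiber_coset \o c).
  by rewrite -image_comp; apply: finite_image.
apply/funext => y; apply/seteqP; split=> [_ [h Ah <-]|x [z czy Axz]] /=.
  by exists y; rewrite // [y + h]addrC addrK.
exists (x - y); last by rewrite addrC subrK.
by rewrite -(subrKA z); apply: AD => //; apply: cA.
Qed.

Lemma finite_index_subgroupT : finite_index_subgroup [set: K].
Proof.
by split=> //; apply: (@finite_index_ideal_fibers _ unit (fun=> tt)).
Qed.

Lemma finite_index_subgroupI A B : finite_index_subgroup A ->
  finite_index_subgroup B -> finite_index_subgroup (A `&` B).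
Proof.
move=> [sgA finA] [sgB finB]; have [A0 AD AN] := sgA; have [B0 BD BN] := sgB.
have sgAB : additive_subgroup (A `&` B).
  split=> // [x y [Ax Bx] [Ay By]|x [Ax Bx]].
    by split; [exact: AD|exact: BD].
  by split; [exact: AN|exact: BN].
split=> //; pose c x := (add_coset A x, add_coset B x).
apply: (finite_index_ideal_fibers (c := c)) => //.
  apply: sub_finite_set (finite_setX finA finB) => _ [x _ <-].
  by split; exists x.
by move=> x y [/(add_coset_eq sgA) Axy /(add_coset_eq sgB) Bxy].
Qed.

Lemma finite_index_subgroup_bigcap (I : choiceType) (D : set I)
    (A : I -> set K) :
  finite_set D -> (forall i, D i -> finite_index_subgroup (A i)) ->
  finite_index_subgroup (\bigcap_(i in D) A i).
Proof.
move=> /finite_seqP[s ->] Afin; rewrite bigcap_seq big_seq.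
by elim/big_ind: _ => //;
  [exact: finite_index_subgroupT|exact: finite_index_subgroupI].
Qed.

Lemma finite_index_subgroup_preimage A (f : {additive K -> K}) :
  finite_index_subgroup A -> finite_index_subgroup (f @^-1` A).
Proof.
move=> [sgA finA]; split; first exact: additive_subgroup_preimage.
apply: (finite_index_ideal_fibers (c := add_coset A \o f)).
- exact: additive_subgroup_preimage.
- by apply: sub_finite_set finA => _ [x _ <-]; exists (f x).
- by move=> x y /(add_coset_eq sgA); rewrite /= raddfB.
Qed.

Lemma finite_index_representatives A : finite_index_subgroup A ->
  exists2 D : set K, finite_set D & forall x, exists2 r, D r & A (x - r).
Proof.
move=> [[A0 _ AN] finA].
exists (xget 0 @` range (add_coset A)); first exact: finite_image.
move=> x; exists (xget 0 (add_coset A x)).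
  by exists (add_coset A x) => //; exists x.
have [h Ah <-] : add_coset A x (xget 0 (add_coset A x)).
  by apply: xgetPex; exists x, 0; rewrite ?addr0.
by rewrite opprD addrA subrr add0r; apply: AN.
Qed.

Section Conductor.
Variable f : K -> {additive K -> K}.
Hypothesis fD : forall a b x, f (a + b) x = f a x + f b x.

Definition conductor A : set K := A `&` \bigcap_a f a @^-1` A.

(* Membership of [f a x] in [A], for [x] in [A], only depends on the class of
   [a] modulo [A]. *)
Lemma conductor_finite_index A :
  finite_index_subgroup A -> (forall a x, A a -> A x -> A (f a x)) ->
  finite_index_subgroup (conductor A).
Proof.
move=> Afin fA; have [D finD DA] := finite_index_representatives Afin.
suff -> : conductor A = A `&` \bigcap_(r in D) f r @^-1` A.
  apply: finite_index_subgroupI => //.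
  apply: finite_index_subgroup_bigcap => // r _.
  exact: finite_index_subgroup_preimage.
apply/seteqP; split=> x [Ax fAx]; split=> // a _; first exact: fAx.
have [r Dr Aar] := DA a; rewrite /= -(subrK r a) fD.
by have [[_ AD _] _] := Afin; apply: AD; [exact: fA|exact: fAx].
Qed.

End Conductor.

(* Lewin's theorem: [L] below is a left ideal, and [conductor rnumul L] the
   largest ideal contained in it. *)
Theorem finite_index_subring_ideal A :
    finite_index_subgroup A -> (forall x y, A x -> A y -> A (numul x y)) ->
  exists I, [/\ ideal I, I `<=` A & finite_index_ideal I].
Proof.
move=> Afin AM; pose L := conductor numul A.
have Lfin : finite_index_subgroup L.
  by apply: conductor_finite_index => // a b x; exact: numulDl.
have LM a x : L x -> L (numul a x).
  by move=> [_ Ax]; split=> [|b _]; [exact: Ax|rewrite /= numulA; exact: Ax].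
have [sgI finI] : finite_index_subgroup (conductor rnumul L).
  by apply: conductor_finite_index => // [a b x|a x La _];
    [exact: numulDr|exact: LM].
exists (conductor rnumul L); split=> // [|x [[]]] //.
split=> // r x [Lx Lxr]; split; split=> [|b _] /=.
- exact: LM.
- by rewrite /rnumul -numulA; apply/LM/Lxr.
- exact: Lxr.
- by rewrite /rnumul -numulA; apply: Lxr.
Qed.

Lemma ideal_mul_subgroup I J : additive_subgroup (ideal_mul I J).
Proof. by apply: additive_subgroup_bigcap => A []. Qed.

Lemma mem_ideal_mul I J x y : I x -> J y -> ideal_mul I J (numul x y).
Proof. by move=> Ix Jy; apply: sub_gen_smallest; exists x => //; exists y. Qed.

Lemma ideal_mul_min A I J :
  additive_subgroup A -> (forall x y, I x -> J y -> A (numul x y)) ->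
  ideal_mul I J `<=` A.
Proof.
by move=> sgA AM; apply: smallest_sub => // _ [x Ix [y Jy <-]]; exact: AM.
Qed.

Lemma ideal_mulSl I I' J : I `<=` I' -> ideal_mul I J `<=` ideal_mul I' J.
Proof.
move=> sII'; apply: ideal_mul_min => [|x y Ix Jy].
  exact: ideal_mul_subgroup.
by apply: mem_ideal_mul => //; apply: sII'.
Qed.

Lemma ideal_mulA_sub I J A :
  ideal_mul (ideal_mul I J) A `<=` ideal_mul I (ideal_mul J A).
Proof.
apply: ideal_mul_min => [|x a IJx Aa]; first exact: ideal_mul_subgroup.
suff : ideal_mul I J `<=` rnumul a @^-1` ideal_mul I (ideal_mul J A) by exact.
apply: ideal_mul_min => [|y z Iy Jz].
  exact/additive_subgroup_preimage/ideal_mul_subgroup.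
by rewrite /= /rnumul -numulA; do 2!apply: mem_ideal_mul => //.
Qed.

(* Meant for [0 < n]: [ideal_exp I 0] is [I]. *)
Definition ideal_exp I n := iter n.-1 (fun J => ideal_mul J I) I.

Lemma ideal_exp_subgroup I n :
  additive_subgroup I -> additive_subgroup (ideal_exp I n).
Proof. by case: n => [|[|n]] //= _; apply: ideal_mul_subgroup. Qed.

Lemma ideal_expD_sub I m n : (0 < m)%N -> (0 < n)%N ->
  ideal_exp I (m + n) `<=` ideal_mul (ideal_exp I m) (ideal_exp I n).
Proof.
case: m n => [//|m] [//|n] _ _; rewrite /ideal_exp addSn addnS /=.
elim: n => [|n IHn]; first by rewrite addn0.
rewrite addnS; apply: subset_trans (@ideal_mulA_sub _ _ _).
exact: ideal_mulSl.
Qed.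

Lemma ideal_exp_2exp (Q : nat -> set K) I m :
    (forall i, additive_subgroup (Q i)) ->
    (forall i x y, Q i x -> Q i y -> Q i.+1 (numul x y)) ->
  I `<=` Q 0 -> ideal_exp I (2 ^ m) `<=` Q m.
Proof.
move=> sgQ QM sIQ; elim: m => [//|m IHm]; rewrite expnS mul2n -addnn.
apply: subset_trans (@ideal_expD_sub _ _ _ _ _) _; rewrite ?expn_gt0//.
by apply: ideal_mul_min => // x y /IHm Qx /IHm; apply: QM.
Qed.

Lemma nilpotent_ideal_exp I n :
  additive_subgroup I -> ideal_exp I n `<=` [set 0] -> nilpotent_ideal I.
Proof.
move=> sgI In0; exists n.-1; apply/seteqP; split=> // _ ->.
by case: (ideal_exp_subgroup n sgI).
Qed.

End NonUnitalRingTheory.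

Section GroupTheory.
Local Open Scope group_scope.
Variable H : groupType.
Implicit Types (x y : H) (A B N : set H).

Definition left_coset N x : set H := [set x * h | h in N].

Lemma left_coset_eq N x y :
  subgroup N -> left_coset N x = left_coset N y -> N (y^-1 * x).
Proof.
case=> N1 _ _ eqxy; have : left_coset N x x by exists 1; rewrite ?mulg1.
by rewrite eqxy => -[h Nh <-]; rewrite mulKg.
Qed.

Lemma subgroup1 : subgroup [set 1 : H].
Proof. by split=> [//|_ _ -> ->|_ ->]; rewrite /= ?mulg1 ?invg1. Qed.

Lemma commutator_subgroup A B : subgroup (commutator A B).
Proof.
split=> [N [[]] //|x y xAB yAB N NP|x xAB N NP].
  by case: (NP) => -[_ + _] _; apply; [apply: xAB|apply: yAB].
by case: (NP) => -[_ _ +] _; apply; apply: xAB.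
Qed.

Lemma mem_commutator A B x y : A x -> B y -> commutator A B [~ x, y].
Proof. by move=> Ax By; apply: sub_gen_smallest; exists x => //; exists y. Qed.

Lemma commutator_min A B N :
  subgroup N -> (forall x y, A x -> B y -> N [~ x, y]) -> commutator A B `<=` N.
Proof.
by move=> sgN NP; apply: smallest_sub => // _ [x Ax [y By <-]]; exact: NP.
Qed.

Lemma commutator_sub N : subgroup N -> commutator N N `<=` N.
Proof.
move=> sgN; have [_ NM NV] := sgN; apply: commutator_min => // x y Nx Ny.
by apply/NM; [exact: NV|apply/NM; [exact: NV|exact: NM]].
Qed.

Lemma derived_subgroup N n :
  subgroup N -> subgroup (iter n (fun A => commutator A A) N).
Proof. by case: n => //= n _; apply: commutator_subgroup. Qed.

Lemma nilpotent_group_central_commg :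
  (forall x y z, commute [~ x, y] z) -> nilpotent_group H.
Proof.
move=> comm_central; pose Z := [set z : H | forall x, commute x z].
have sgZ : subgroup Z.
  by split=> [x|y z Zy Zz x|y Zy x];
    [exact: commute1|exact: commuteM|exact: commuteV].
have Zcomm : commutator [set: H] [set: H] `<=` Z.
  by apply: commutator_min => // x y _ _ z; apply/commute_sym/comm_central.
exists 2; apply/seteqP; split=> [|_ ->] /=.
  apply: commutator_min => [|z x /Zcomm Zz _]; first exact: subgroup1.
  exact/eqP/commgP/commute_sym/Zz.
by case: (commutator_subgroup (commutator [set: H] [set: H]) [set: H]).
Qed.

End GroupTheory.

Section AdditiveToMultiplicative.
Variables (K : nonUnitalRingType) (H : groupType) (f : K -> H) (N : set H).
Hypothesis fD : {morph f : x y / x + y >-> (x * y)%g}.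
Hypothesis sgN : subgroup N.

Lemma morph_add0 : f 0 = 1%g.
Proof. by apply: (mulgI (f 0)); rewrite -fD addr0 mulg1. Qed.

Lemma morph_addN x : f (- x) = (f x)^-1%g.
Proof. by apply: (mulgI (f x)); rewrite -fD subrr mulgV morph_add0. Qed.

Lemma additive_subgroup_preimage_morph : additive_subgroup (f @^-1` N).
Proof.
have [N1 NM NV] := sgN; split=> [|x y Nx Ny|x Nx] /=.
- by rewrite morph_add0.
- by rewrite fD; apply: NM.
- by rewrite morph_addN; apply: NV.
Qed.

Lemma finite_index_subgroup_preimage_morph :
  finite_index N -> finite_index_subgroup (f @^-1` N).
Proof.
move=> finN; split; first exact: additive_subgroup_preimage_morph.
apply: (finite_index_ideal_fibers (c := left_coset N \o f)).
- exact: additive_subgroup_preimage_morph.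
- by apply: sub_finite_set finN => _ [x _ <-]; exists (f x).
- by move=> x y /(left_coset_eq sgN); rewrite /= [x - y]addrC fD morph_addN.
Qed.

End AdditiveToMultiplicative.

(** * The group of quasi-invertible elements *)

Section CircleGroup.
Variable L : nonUnitalRingType.
Implicit Types x y z : L.

Definition circ x y := x + y + numul x y.

Lemma circA : associative circ.
Proof.
move=> x y z; rewrite /circ !(numulDl, numulDr) numulA -!addrA.
do 2![congr (_ + _)]; rewrite [numul y z + _]addrCA addrCA.
by do 2![congr (_ + _)]; rewrite addrCA.
Qed.

Lemma circ0r : left_id 0 circ.
Proof. by move=> x; rewrite /circ add0r numul0r addr0. Qed.

Lemma circr0 : right_id 0 circ.
Proof. by move=> x; rewrite /circ addr0 numulr0 addr0. Qed.

Definition quasi_inverse x y := circ x y = 0 /\ circ y x = 0.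

Definition quasi_invertible x := `[< exists y, quasi_inverse x y >].

Lemma quasi_inverse_invertible x y : quasi_inverse x y -> quasi_invertible x.
Proof. by move=> xy; apply/asboolP; exists y. Qed.

Definition circle_group := {x : L | quasi_invertible x}.

HB.instance Definition _ := SubChoice.on circle_group.

Implicit Types g h : circle_group.

Definition circle_one : circle_group :=
  Sub 0 (quasi_inverse_invertible (conj (circ0r 0) (circ0r 0))).

Fact quasi_invertible_circ g h : quasi_invertible (circ (val g) (val h)).
Proof.
have /asboolP[x' [xx' x'x]] := valP g; have /asboolP[y' [yy' y'y]] := valP h.
apply: (@quasi_inverse_invertible _ (circ y' x')); split.
  by rewrite circA -(circA (val g)) yy' circr0.
by rewrite circA -(circA y') x'x circr0.
Qed.

Definition circle_mul g h : circle_group :=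
  Sub (circ (val g) (val h)) (quasi_invertible_circ g h).

Fact quasi_inverse_exists g : exists h, quasi_inverse (val g) (val h).
Proof.
have /asboolP[y [xy yx]] := valP g.
by exists (Sub y (quasi_inverse_invertible (conj yx xy))).
Qed.

Definition circle_inv g := sval (cid (quasi_inverse_exists g)).

Fact circle_mulA : associative circle_mul.
Proof. by move=> x y z; apply: val_inj; rewrite /= circA. Qed.

Fact circle_mul1g : left_id circle_one circle_mul.
Proof. by move=> x; apply: val_inj; rewrite /= circ0r. Qed.

Fact circle_mulg1 : right_id circle_one circle_mul.
Proof. by move=> x; apply: val_inj; rewrite /= circr0. Qed.

Fact circle_mulVg : left_inverse circle_one circle_inv circle_mul.
Proof. by move=> g; apply: val_inj; rewrite /circle_inv; case: cid => h []. Qed.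

Fact circle_mulgV : right_inverse circle_one circle_inv circle_mul.
Proof. by move=> g; apply: val_inj; rewrite /circle_inv; case: cid => h []. Qed.

HB.instance Definition _ := isGroup.Build circle_group
  circle_mulA circle_mul1g circle_mulg1 circle_mulVg circle_mulgV.

Lemma val_circleM g h : val (g * h)%g = circ (val g) (val h).
Proof. by []. Qed.

(* In terms of [1 + x] and [1 + y]: if [y x = x x y = 0], then
   [(1 + x) (1 + y) = (1 + y) (1 + x) (1 + x y)]. *)
Lemma circle_commutator g h k :
    numul (val h) (val g) = 0 -> numul (val g) (numul (val g) (val h)) = 0 ->
  val k = numul (val g) (val h) -> [~ g, h]%g = k.
Proof.
move=> yx xxy kE; apply: (mulgI (h * g)%g); rewrite -commgC; apply: val_inj.
rewrite !val_circleM kE /circ yx addr0 numulDl xxy addr0 numulA yx numul0r.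
by rewrite addr0 [val h + _]addrC.
Qed.

End CircleGroup.

Section Matrix.
Variables (K : nonUnitalRingType) (n : nat).

Definition numatrix := 'M[K]_n.

HB.instance Definition _ := GRing.Zmodule.on numatrix.

Implicit Types M N P : numatrix.

Definition numulmx M N : numatrix :=
  \matrix_(i, j) \sum_k numul (M i k) (N k j).

Fact numulmxA : associative numulmx.
Proof.
move=> M N P; apply/matrixP => i j; rewrite !mxE.
under eq_bigr do rewrite mxE numul_sumr.
under [RHS]eq_bigr do rewrite mxE numul_suml.
by rewrite exchange_big; do 2!apply: eq_bigr => ? _; rewrite numulA.
Qed.

Fact numulmxDl : left_distributive numulmx +%R.
Proof.
move=> M N P; apply/matrixP => i j; rewrite !mxE -big_split.
by apply: eq_bigr => k _; rewrite mxE numulDl.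
Qed.

Fact numulmxDr : right_distributive numulmx +%R.
Proof.
move=> M N P; apply/matrixP => i j; rewrite !mxE -big_split.
by apply: eq_bigr => k _; rewrite mxE numulDr.
Qed.

HB.instance Definition _ :=
  Zmodule_isNonUnitalRing.Build numatrix numulmxA numulmxDl numulmxDr.

Definition unit_mx (i j : 'I_n) (a : K) : numatrix :=
  \matrix_(k, l) (if (k == i) && (l == j) then a else 0).

Lemma unit_mxD i j : {morph unit_mx i j : a b / a + b}.
Proof.
by move=> a b; apply/matrixP => k l; rewrite !mxE; case: ifP; rewrite ?addr0.
Qed.

Lemma unit_mx0 i j : unit_mx i j 0 = 0.
Proof. by apply/matrixP => k l; rewrite !mxE if_same. Qed.

Lemma numul_unit_mx i j k a b :
  numul (unit_mx i j a) (unit_mx j k b) = unit_mx i k (numul a b).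
Proof.
apply/matrixP => p q; rewrite !mxE (bigD1 j)//= big1 ?addr0 => [|l /negPf lj].
  by rewrite !mxE !eqxx andbT; case: (p == i); case: (q == k);
     rewrite /= ?(numul0r, numulr0).
by rewrite !mxE lj andbF numul0r.
Qed.

Lemma numul_unit_mx_neq i j k l a b :
  j != k -> numul (unit_mx i j a) (unit_mx k l b) = 0.
Proof.
move=> /negPf jk; apply/matrixP => p q; rewrite !mxE big1 // => r _.
rewrite !mxE; case: (eqVneq r j) => [->|]; first by rewrite jk /= numulr0.
by rewrite andbF numul0r.
Qed.

Lemma circ_unit_mx i j a b : i != j ->
  circ (unit_mx i j a) (unit_mx i j b) = unit_mx i j (a + b).
Proof.
by move=> ij; rewrite /circ numul_unit_mx_neq 1?eq_sym// addr0 unit_mxD.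
Qed.

(* Meant for [i != j], where it stands for the matrix [1 + a e_ij]. *)
Definition elem_mx (i j : 'I_n) (a : K) : circle_group numatrix :=
  insubd (1%g : circle_group numatrix) (unit_mx i j a).

Lemma val_elem_mx i j a : i != j -> val (elem_mx i j a) = unit_mx i j a.
Proof.
move=> ij; apply: insubdK.
apply: (@quasi_inverse_invertible _ _ (unit_mx i j (- a))).
by split; rewrite circ_unit_mx// ?subrr ?addNr unit_mx0.
Qed.

Lemma elem_mxD i j : i != j ->
  {morph elem_mx i j : a b / a + b >-> (a * b)%g}.
Proof.
move=> ij a b; apply: val_inj.
by rewrite val_circleM !val_elem_mx// circ_unit_mx.
Qed.

Lemma elem_mx_eq1 i j a : i != j -> elem_mx i j a = 1%g -> a = 0.
Proof.
move=> ij /(congr1 val); rewrite val_elem_mx// => /matrixP/(_ i j).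
by rewrite !mxE !eqxx.
Qed.

Lemma elem_mx_commutator i j k a b : i != j -> j != k -> i != k ->
  [~ elem_mx i j a, elem_mx j k b]%g = elem_mx i k (numul a b).
Proof.
move=> ij jk ik; apply: circle_commutator.
- by rewrite !val_elem_mx// numul_unit_mx_neq// eq_sym.
- by rewrite !val_elem_mx// numul_unit_mx numul_unit_mx_neq// eq_sym.
- by rewrite !val_elem_mx// numul_unit_mx.
Qed.

End Matrix.

Section ElemCoefs.
Variables (K : nonUnitalRingType) (n : nat).
Implicit Types N : set (circle_group (numatrix K n)).

Definition elem_coefs N : set K :=
  \bigcap_(p in [set p : 'I_n * 'I_n | p.1 != p.2]) elem_mx p.1 p.2 @^-1` N.

Lemma elem_coefs_subgroup N : subgroup N -> additive_subgroup (elem_coefs N).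
Proof.
move=> sgN; apply: additive_subgroup_bigcap => p /elem_mxD fD.
exact: additive_subgroup_preimage_morph.
Qed.

Lemma elem_coefs_finite_index N :
  subgroup N -> finite_index N -> finite_index_subgroup (elem_coefs N).
Proof.
move=> sgN finN; apply: finite_index_subgroup_bigcap => [|p /elem_mxD fD].
  exact: finite_finset.
exact: finite_index_subgroup_preimage_morph.
Qed.

End ElemCoefs.

Lemma ord_third_index n (i k : 'I_n.+3) : exists2 j, i != j & j != k.
Proof.
have /card_gt0P[j] : (0 < #|[predC pred2 i k]|)%N.
  rewrite -(ltn_add2l #|pred2 i k|) cardC card_ord card2 addn0.
  by case: (i != k).
by rewrite inE /= negb_or eq_sym => /andP[ij jk]; exists j.
Qed.

Lemma elem_coefs_commutator (K : nonUnitalRingType) n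
    (N N' : set (circle_group (numatrix K n.+3))) a b :
  elem_coefs N a -> elem_coefs N' b -> elem_coefs (commutator N N') (numul a b).
Proof.
move=> Na N'b [i k] /= ik; have [j ij jk] := ord_third_index i k.
rewrite -(elem_mx_commutator _ _ ij jk ik).
by apply: mem_commutator; [exact: (Na (i, j))|exact: (N'b (j, k))].
Qed.

Theorem circle_group_nilpotent_by_finite (K : nonUnitalRingType) n :
  solvable_by_finite (circle_group (numatrix K n.+3)) -> nilpotent_by_finite K.
Proof.
case=> N [[sgN _] [m Nm1] finN]; pose D i := iter i (fun A => commutator A A) N.
have [|J [idJ sJ finJ]] :=
    finite_index_subring_ideal (elem_coefs_finite_index sgN finN).
  move=> a b Na Nb p p12; apply: commutator_sub => //.
  exact: elem_coefs_commutator p12.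
have sJD : ideal_exp J (2 ^ m) `<=` elem_coefs (D m).
  apply: (@ideal_exp_2exp _ (fun i => elem_coefs (D i))) => // [i|i a b].
    exact/elem_coefs_subgroup/derived_subgroup.
  exact: elem_coefs_commutator.
exists J; split=> //; apply: (@nilpotent_ideal_exp _ _ (2 ^ m)) => [|a /sJD].
  by case: idJ.
by rewrite /D Nm1 => /(_ (ord0, ord_max) isT) /elem_mx_eq1; apply.
Qed.

(** * The Heisenberg group *)

Section Heisenberg.
Variable K : nonUnitalRingType.

(* [(a, b, c)] stands for the matrix [[1, a, c], [0, 1, b], [0, 0, 1]]. *)
Definition heisenberg := (K * K * K)%type.

HB.instance Definition _ := Choice.on heisenberg.

Implicit Types h : heisenberg.

Definition heis_mul h h' : heisenberg :=
  (h.1.1 + h'.1.1, h.1.2 + h'.1.2, h.2 + h'.2 + numul h.1.1 h'.1.2).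

Definition heis_one : heisenberg := (0, 0, 0).

Definition heis_inv h : heisenberg :=
  (- h.1.1, - h.1.2, numul h.1.1 h.1.2 - h.2).

Fact heis_mulA : associative heis_mul.
Proof.
move=> [[a b] c] [[a' b'] c'] [[a'' b''] c'']; rewrite /heis_mul /= !addrA.
congr (_, _, _); rewrite numulDl numulDr -!addrA; do 2![congr (_ + _)].
by rewrite [RHS]addrCA; congr (_ + _); rewrite addrC -addrA.
Qed.

Fact heis_mul1g : left_id heis_one heis_mul.
Proof.
by move=> [[a b] c]; rewrite /heis_mul /= !add0r numul0r addr0.
Qed.

Fact heis_mulg1 : right_id heis_one heis_mul.
Proof.
by move=> [[a b] c]; rewrite /heis_mul /= !addr0 numulr0 addr0.
Qed.

Fact heis_mulVg : left_inverse heis_one heis_inv heis_mul.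
Proof.
by move=> [[a b] c]; rewrite /heis_mul /= !addNr subrK numulNr subrr.
Qed.

Fact heis_mulgV : right_inverse heis_one heis_inv heis_mul.
Proof.
move=> [[a b] c]; rewrite /heis_mul /= !subrr numulrN.
by rewrite [c + _]addrC subrK subrr.
Qed.

HB.instance Definition _ := isGroup.Build heisenberg
  heis_mulA heis_mul1g heis_mulg1 heis_mulVg heis_mulgV.

Lemma heis_mulE h h' : (h * h')%g =
  (h.1.1 + h'.1.1, h.1.2 + h'.1.2, h.2 + h'.2 + numul h.1.1 h'.1.2).
Proof. by []. Qed.

Lemma heis_commutator h h' :
  [~ h, h']%g = (0, 0, numul h.1.1 h'.1.2 - numul h'.1.1 h.1.2).
Proof.
apply: (mulgI (h' * h)%g); rewrite -commgC !heis_mulE /= numulr0 !addr0.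
rewrite [_ + h'.1.1]addrC [_ + h'.1.2]addrC [h.2 + _]addrC -[in RHS]addrA.
by rewrite [numul h'.1.1 _ + _]addrC subrK.
Qed.

Lemma heisenberg_nilpotent : nilpotent_group heisenberg.
Proof.
apply: nilpotent_group_central_commg => h h' k; apply/commgP/eqP.
by rewrite !heis_commutator /= numul0r numulr0 subrr.
Qed.

Theorem heisenberg_null_by_finite :
  abelian_by_finite heisenberg -> null_by_finite K.
Proof.
case=> N [[sgN _] abN finN].
pose f x : heisenberg := (x, 0, 0); pose g x : heisenberg := (0, x, 0).
have fD : {morph f : x y / x + y >-> (x * y)%g}.
  by move=> x y; rewrite heis_mulE /= numulr0 !addr0.
have gD : {morph g : x y / x + y >-> (x * y)%g}.
  by move=> x y; rewrite heis_mulE /= numul0r !addr0.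
pose A := f @^-1` N `&` g @^-1` N.
have Afin : finite_index_subgroup A.
  by apply: finite_index_subgroupI; exact: finite_index_subgroup_preimage_morph.
have AM0 x y : A x -> A y -> numul x y = 0.
  move=> [Nfx _] [_ Ngy]; have /commgP/eqP : commute (f x) (g y) by exact: abN.
  by rewrite heis_commutator /= numul0r subr0 => -[].
have [|J [idJ sJA finJ]] := finite_index_subring_ideal Afin.
  by move=> x y Ax Ay; rewrite AM0//; case: Afin => -[].
exists J; split=> //; apply/seteqP; split=> [|_ ->].
  apply: ideal_mul_min => [|x y /sJA Ax /sJA Ay]; last exact: AM0.
  exact: additive_subgroup0.
by case: (ideal_mul_subgroup J J).
Qed.

End Heisenberg.

(** * *-closed sets *)

Definition case_sum (T V W : Type) (x : V -> T) (y : W -> T) (i : V + W) : T :=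
  match i with inl v => x v | inr w => y w end.

Lemma case_sum_eta (T V W : Type) (r : V + W -> T) :
  case_sum (r \o inl) (r \o inr) = r.
Proof. by apply/funext => -[]. Qed.

Lemma comp_case_sum (T T' V W : Type) (x : V -> T) (y : W -> T) (r : T -> T') :
  r \o case_sum x y = case_sum (r \o x) (r \o y).
Proof. by apply/funext => -[]. Qed.

Section ProductTopology.

Lemma continuous_pair (T U V : topologicalType) (f : T -> U) (f' : T -> V) :
  continuous f -> continuous f' -> continuous (fun t => (f t, f' t)).
Proof. by move=> cf cf' t; apply: cvg_pair; [exact: cf|exact: cf']. Qed.

Lemma continuous_map_pair (T T' U U' : topologicalType) (f : T -> U)
    (f' : T' -> U') :
  continuous f -> continuous f' ->
  continuous (fun p : T * T' => (f p.1, f' p.2)).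
Proof.
move=> cf cf'; apply: continuous_pair => p.
  by apply: (@cvg_comp _ _ _ fst f); [exact: cvg_fst|exact: cf].
by apply: (@cvg_comp _ _ _ snd f'); [exact: cvg_snd|exact: cf'].
Qed.

Lemma continuous_into_prod (I : Type) (T : I -> topologicalType)
    (W : topologicalType) (f : W -> prod_topology T) :
  (forall i, continuous (fun w => f w i)) -> continuous f.
Proof.
move=> cf w; apply/cvg_sup => i U [V] [[B oB <-]] Bw BU.
apply: filterS BU _; apply: (cf i w B); exact: open_nbhs_nbhs.
Qed.

Lemma prod_topology_compact (I : eqType) (T : I -> topologicalType) :
  (forall i, compact [set: T i]) -> compact [set: prod_topology T].
Proof.
move=> cT; have := tychonoff cT.
by rewrite (_ : [set f | _] = setT)//; apply/seteqP; split.
Qed.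

Lemma case_sum_continuous (V W : eqType) (S : topologicalType) :
  continuous (fun p : {ptws V -> S} * {ptws W -> S} =>
                case_sum p.1 p.2 : {ptws (V + W)%type -> S}).
Proof.
apply: continuous_into_prod => -[i|i] p /=.
  apply: (@cvg_comp _ _ _ fst (proj i)); first exact: cvg_fst.
  exact: proj_continuous.
apply: (@cvg_comp _ _ _ snd (proj i)); first exact: cvg_snd.
exact: proj_continuous.
Qed.

Lemma closed_projection (T U : topologicalType) (D : set (T * U)) :
  compact [set: U] -> closed D -> closed [set t | exists s, D (t, s)].
Proof.
move=> /compact_near_coveringP cU cD t tD; apply: contrapT => nDt.
have nearD : \near t, [set: U] `<=` (fun s => ~ D (t, s)).
  apply: (cU _ (nbhs t) (fun t s => ~ D (t, s))) => s _.
  have : nbhs (t, s) (~` D).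
    apply: open_nbhs_nbhs; split; first exact: closed_openC.
    by move=> Dts; apply: nDt; exists s.
  move=> [[A B] /= [At Bs] AB]; exists (B, A) => // -[s' t'] /= [Bs' At'].
  exact: (AB (t', s')).
have [t' [[s Dts] /(_ s I)]] := tD _ nearD; exact.
Qed.

End ProductTopology.

Section StarClosedSets.
Variables (G : topGroupType) (Y : Type) (actY : G -> Y -> Y).

Definition pair_act (T U : Type) (aT : G -> T -> T) (aU : G -> U -> U) (g : G)
    (p : T * U) : T * U := (aT g p.1, aU g p.2).

Definition prod_act (I : Type) (T : I -> Type) (a : forall i, G -> T i -> T i)
    (g : G) (x : prod_topology T) : prod_topology T := fun i => a i g (x i).

Lemma star_closedI (T : topologicalType) (aT : G -> T -> T) (D E : set T) :
  star_closed actY aT D -> star_closed actY aT E ->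
  star_closed actY aT (D `&` E).
Proof.
move=> [A finA [cD AD]] [B finB [cE BE]].
exists (A `|` B); first by rewrite finite_setU.
split=> [|g t ABg [Dt Et]]; first exact: closedI.
by split; [apply: AD|apply: BE] => // y ?; apply: ABg; [left|right].
Qed.

Lemma star_closed_bigcap (T : topologicalType) (aT : G -> T -> T) (I : finType)
    (D : I -> set T) :
  (forall i, star_closed actY aT (D i)) -> star_closed actY aT (\bigcap_i D i).
Proof.
move=> DP; have /choice[A AP] i : exists A : set Y,
    finite_set A /\ closed_over actY A aT (D i).
  by have [A finA AD] := DP i; exists A.
exists (\bigcup_i A i).
  by apply: bigcup_finite => [|i _]; [exact: finite_finset|exact: (AP i).1].
split=> [|g t Ag Dt i _]; first by apply: closed_bigI => i _; exact: (AP i).2.1.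
by apply: (AP i).2.2 => [y Ay|]; [apply: Ag; exists i|exact: Dt].
Qed.

Lemma star_closed_preimage (T U : topologicalType) (aT : G -> T -> T)
    (aU : G -> U -> U) (f : T -> U) (D : set U) :
    continuous f -> (forall g t, f (aT g t) = aU g (f t)) ->
  star_closed actY aU D -> star_closed actY aT (f @^-1` D).
Proof.
move=> cf fa [A finA [cD AD]]; exists A => //.
split=> [|g t Ag Dft /=]; last by rewrite fa; apply: AD.
by apply: preimage_closed => // t _; apply: cf.
Qed.

Lemma star_closed_projection (T U : topologicalType) (aT : G -> T -> T)
    (aU : G -> U -> U) (D : set (T * U)) :
    compact [set: U] -> star_closed actY (pair_act aT aU) D ->
  star_closed actY aT [set t | exists s, D (t, s)].
Proof.
move=> cU [A finA [cD AD]]; exists A => //.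
split=> [|g t Ag [s Ds]]; first exact: closed_projection.
by exists (aU g s); apply: (AD g (t, s)).
Qed.

Lemma star_closed_group_in_bijection (S S' : topologicalType) (aS : G -> S -> S)
    (aS' : G -> S' -> S') (phi : S' -> S) (psi : S -> S') (H : groupType)
    (v : H -> S) :
    cancel psi phi -> cancel phi psi -> continuous phi ->
    (forall g s, phi (aS' g s) = aS g (phi s)) ->
  star_closed_group_in actY aS v -> star_closed_group_in actY aS' (psi \o v).
Proof.
move=> psiK phiK cphi phi_act [v_inj v_range v_graph]; split.
- exact: inj_comp (can_inj psiK) v_inj.
- rewrite (_ : range _ = phi @^-1` range v).
    exact: star_closed_preimage v_range.
  apply/seteqP; split=> [_ [h _ <-]|s [h _ vh]].
    by exists h; rewrite //= psiK.
  by exists h; rewrite //= vh phiK.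
pose phi3 (p : S' * S' * S') := (phi p.1.1, phi p.1.2, phi p.2).
rewrite (_ : op_graph _ _ = phi3 @^-1` op_graph v (fun x y => (x * y)%g)).
  apply: star_closed_preimage v_graph => [|g p]; last by rewrite /phi3 !phi_act.
  exact: continuous_map_pair (continuous_map_pair cphi cphi) cphi.
apply/seteqP; split=> [_ [h [h' ->]]|[[s1 s2] s3] [h [h' [e1 e2 e3]]]].
  by exists h, h'; rewrite /phi3 /= !psiK.
by exists h, h'; rewrite /= -e1 -e2 -e3 !phiK.
Qed.

End StarClosedSets.

(** * Polynomial presentations of the matrix groups *)

Section MatrixEntries.
Variables (K : nonUnitalRingType) (n : nat).
Implicit Types (M N : numatrix K n) (p : 'I_n * 'I_n).

Definition mx_entries M p := M p.1 p.2.

Definition mx_of_entries (x : 'I_n * 'I_n -> K) : numatrix K n :=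
  \matrix_(i, j) x (i, j).

Lemma mx_entriesK : cancel mx_entries mx_of_entries.
Proof. by move=> M; apply/matrixP => i j; rewrite mxE. Qed.

Lemma mx_of_entriesK : cancel mx_of_entries mx_entries.
Proof. by move=> x; apply/funext => -[i j]; rewrite /mx_entries mxE. Qed.

Definition circ_entry p (r : 'I_n * 'I_n + 'I_n * 'I_n -> K) :=
  r (inl p) + r (inr p) +
  \sum_(k < n) numul (r (inl (p.1, k))) (r (inr (k, p.2))).

Lemma circ_entryE M N p :
  circ_entry p (case_sum (mx_entries M) (mx_entries N)) =
  mx_entries (circ M N) p.
Proof. by rewrite /mx_entries !mxE. Qed.

Lemma circ_entry_eq0 M N :
  circ M N = 0 <->
  forall p, circ_entry p (case_sum (mx_entries M) (mx_entries N)) = 0.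
Proof.
split=> [MN0 p|MN0]; first by rewrite circ_entryE MN0 /mx_entries mxE.
apply/(can_inj mx_entriesK)/funext => p.
by rewrite -circ_entryE MN0 /mx_entries mxE.
Qed.

Lemma range_circle_group_entries :
  range (fun g : circle_group (numatrix K n) => mx_entries (val g)) =
  [set x | exists y, forall p,
     circ_entry p (case_sum x y) = 0 /\ circ_entry p (case_sum y x) = 0].
Proof.
apply/seteqP; split=> [_ [g _ <-]|x [y xy]] /=.
  have /asboolP[N [gN Ng]] := valP g; exists (mx_entries N) => p.
  by split; move: p; apply/circ_entry_eq0.
have qi : quasi_inverse (mx_of_entries x) (mx_of_entries y).
  by split; apply/circ_entry_eq0 => p; rewrite !mx_of_entriesK; case: (xy p).
exists (Sub (mx_of_entries x) (quasi_inverse_invertible qi)) => //.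
exact: mx_of_entriesK.
Qed.

End MatrixEntries.

Section HeisenbergCoordinates.
Variable K : nonUnitalRingType.

Definition heis_coords (h : heisenberg K) (i : 'I_3) : K :=
  [:: h.1.1; h.1.2; h.2]`_i.

Definition heis_coord_mul (i : 'I_3) (r : 'I_3 + 'I_3 -> K) : K :=
  r (inl i) + r (inr i) +
  (if i == ord_max then numul (r (inl 0)) (r (inr 1)) else 0).

Lemma heis_coords_inj : injective heis_coords.
Proof.
move=> [[a b] c] [[a' b'] c'] hh'; congr (_, _, _).
- exact: (congr1 (@^~ 0) hh').
- exact: (congr1 (@^~ 1) hh').
- exact: (congr1 (@^~ ord_max) hh').
Qed.

Lemma range_heis_coords : range heis_coords = [set: 'I_3 -> K].
Proof.
apply/seteqP; split=> // x _; exists (x 0, x 1, x ord_max) => //.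
by apply/funext => -[[|[|[]]] //= lti]; congr x; apply: val_inj.
Qed.

End HeisenbergCoordinates.

(** * *-closed relations and functions on a *-closed ring *)

Section StarClosedRing.
Variables (G : topGroupType) (Y : Type) (actY : G -> Y -> Y).
Variables (S : topologicalType) (aS : G -> S -> S).
Hypothesis cS : compact [set: S].
Variables (K : nonUnitalRingType) (u : K -> S).
Hypothesis uP : star_closed_ring_in actY aS u.
Implicit Types (V W : finType).

Definition encode (V : Type) (x : V -> K) : {ptws V -> S} := fun v => u (x v).

Definition star_closed_rel (V : Type) (D : set (V -> K)) :=
  star_closed actY (prod_act (fun=> aS)) (@encode V @` D).

Definition star_closed_op (op : K -> K -> K) :=
  star_closed actY (diag3 aS) (op_graph u op).

Let u_inj : injective u. Proof. by case: uP. Qed.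

Lemma star_closed_op_add : star_closed_op +%R. Proof. by case: uP. Qed.

Lemma star_closed_op_numul : star_closed_op numul. Proof. by case: uP. Qed.

Lemma encode_inj (V : Type) : injective (@encode V).
Proof.
by move=> x y xy; apply/funext => v; exact: u_inj (congr1 (@^~ v) xy).
Qed.

Lemma preimage_image_encode (V : Type) (D : set (V -> K)) :
  @encode V @^-1` (@encode V @` D) = D.
Proof.
by apply/seteqP; split=> x; [case=> y Dy /encode_inj <-|exact: preimage_image].
Qed.

Lemma op_graphE op a b c : op_graph u op (u a, u b, u c) = (c = op a b).
Proof.
apply/propext; split=> [[x [y [/u_inj -> /u_inj -> /u_inj]]] //|->].
by exists a, b.
Qed.

Lemma star_closed_rel_preimage V (E : set {ptws V -> S}) :
  star_closed actY (prod_act (fun=> aS)) E ->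
  star_closed_rel (@encode V @^-1` E).
Proof.
move=> EP; have [_ rangeP _ _] := uP.
rewrite /star_closed_rel (_ : _ @` _ =
    E `&` \bigcap_v (fun t : {ptws V -> S} => t v) @^-1` range u).
  apply: star_closedI => //; apply: star_closed_bigcap => v.
  by apply: star_closed_preimage rangeP => // ; apply: proj_continuous.
apply/seteqP; split=> [_ [x Ex <-]|t [Et t_range]].
  by split=> // v _; exists (x v).
have /choice[x xt] v : exists a, u a = t v.
  by case: (t_range v I) => a; exists a.
have tE : encode x = t by exact/funext.
by exists x; rewrite //= tE.
Qed.

Lemma star_closed_relT V : star_closed_rel [set: V -> K].
Proof.
rewrite -(preimage_setT (@encode V)); apply: star_closed_rel_preimage.
by exists set0 => //; split=> //; exact: closedT.
Qed.

Lemma star_closed_relI V (D E : set (V -> K)) :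
  star_closed_rel D -> star_closed_rel E -> star_closed_rel (D `&` E).
Proof.
move=> DP EP.
rewrite -(preimage_image_encode D) -(preimage_image_encode E) -preimage_setI.
exact/star_closed_rel_preimage/star_closedI.
Qed.

Lemma star_closed_rel_forall V (I : finType) (D : I -> set (V -> K)) :
  (forall i, star_closed_rel (D i)) ->
  star_closed_rel [set x | forall i, D i x].
Proof.
move=> DP; rewrite (_ : mkset _ = \bigcap_i D i); last first.
  by apply/seteqP; split=> x Dx i; [move=> _|]; apply: Dx.
rewrite -(eq_bigcapr (fun i _ => preimage_image_encode (D i))) -preimage_bigcap.
exact/star_closed_rel_preimage/star_closed_bigcap.
Qed.

Lemma star_closed_rel_reindex V W (s : V -> W) (D : set (V -> K)) :
  star_closed_rel D -> star_closed_rel [set x : W -> K | D (x \o s)].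
Proof.
move=> DP; pose restr (t : {ptws W -> S}) : {ptws V -> S} := t \o s.
rewrite (_ : mkset _ = @encode W @^-1` (restr @^-1` (@encode V @` D))).
  apply: star_closed_rel_preimage; apply: star_closed_preimage DP => //.
  by apply: continuous_into_prod => v; exact: proj_continuous.
by rewrite -{1}(preimage_image_encode D).
Qed.

Lemma star_closed_rel_exists V W (D : (V -> K) -> (W -> K) -> Prop) :
    star_closed_rel [set r : V + W -> K | D (r \o inl) (r \o inr)] ->
  star_closed_rel [set x | exists y, D x y].
Proof.
set D' := mkset _ => D'P.
pose glue (p : {ptws V -> S} * {ptws W -> S}) : {ptws (V + W)%type -> S} :=
  case_sum p.1 p.2.
have glue_encode x y : glue (encode x, encode y) = encode (case_sum x y).
  by apply/funext => -[].
rewrite (_ : mkset _ = @encode V @^-1`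
    [set t | exists t', (glue @^-1` (@encode _ @` D')) (t, t')]).
  apply: star_closed_rel_preimage.
  apply: (star_closed_projection (aU := prod_act (fun=> aS))).
    exact: prod_topology_compact.
  apply: star_closed_preimage D'P; first exact: case_sum_continuous.
  by move=> g p; apply/funext => -[].
apply/seteqP; split=> x [y].
  move=> Dxy; exists (encode y); rewrite /= glue_encode.
  by exists (case_sum x y).
move=> [r D'r rxy]; exists (r \o inr).
suff <- : r \o inl = x by [].
by apply: encode_inj; apply/funext => v; apply: (congr1 (@^~ (inl v)) rxy).
Qed.

Lemma star_closed_rel_op V (op : K -> K -> K) i j k :
  star_closed_op op -> star_closed_rel [set x : V -> K | x k = op (x i) (x j)].
Proof.
move=> opP; pose coords (t : {ptws V -> S}) := (t i, t j, t k).
rewrite (_ : mkset _ = @encode V @^-1` (coords @^-1` op_graph u op)).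
  apply: star_closed_rel_preimage; apply: star_closed_preimage opP => //.
  by apply: continuous_pair; [apply: continuous_pair|]; exact: proj_continuous.
by apply/funext => x; rewrite /preimage /= op_graphE.
Qed.

Lemma star_closed_rel_eq0 V i : star_closed_rel [set x : V -> K | x i = 0].
Proof.
rewrite (_ : mkset _ = [set x | x i = x i + x i]).
  exact: star_closed_rel_op star_closed_op_add.
apply/seteqP; split=> x /= xi; first by rewrite xi addr0.
by apply: (addrI (x i)); rewrite addr0.
Qed.

(* Written as [x i = x j + 0], since the diagonal of [S] need not be closed. *)
Lemma star_closed_rel_eq V i j : star_closed_rel [set x : V -> K | x i = x j].
Proof.
rewrite (_ : mkset _ =
    [set x | exists z : unit -> K, z tt = 0 /\ x i = x j + z tt]).
  apply: star_closed_rel_exists; apply: star_closed_relI.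
    exact: (@star_closed_rel_eq0 _ (inr tt)).
  exact: (star_closed_rel_op (inl j) (inr tt) (inl i) star_closed_op_add).
apply/seteqP; split=> x /=; first by exists (fun=> 0); rewrite addr0.
by move=> [z [-> ->]]; rewrite addr0.
Qed.

Definition star_closed_fun (V : Type) (F : (V -> K) -> K) :=
  star_closed_rel [set x : option V -> K | x None = F (x \o Some)].

Lemma star_closed_rel_graph V W (F : (V -> K) -> K) (s : V -> W) w :
  star_closed_fun F -> star_closed_rel [set x : W -> K | x w = F (x \o s)].
Proof. exact: (@star_closed_rel_reindex _ _ (oapp s w)). Qed.

Lemma star_closed_fun_case_sum V V' W (F : (V + V' -> K) -> K) (f : V -> W)
    (f' : V' -> W) :
    star_closed_fun F ->
  star_closed_fun (fun x : W -> K => F (case_sum (x \o f) (x \o f'))).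
Proof.
under [in X in _ -> X]eq_fun do rewrite -comp_case_sum.
exact: (star_closed_rel_graph (Some \o case_sum f f') None).
Qed.

Lemma star_closed_fun_proj V (v : V) : star_closed_fun (fun x : V -> K => x v).
Proof. exact: star_closed_rel_eq. Qed.

Lemma star_closed_fun0 V : star_closed_fun (fun _ : V -> K => 0).
Proof. exact: star_closed_rel_eq0. Qed.

Lemma star_closed_fun_op V (op : K -> K -> K) (F F' : (V -> K) -> K) :
    star_closed_op op -> star_closed_fun F -> star_closed_fun F' ->
  star_closed_fun (fun x => op (F x) (F' x)).
Proof.
move=> opP FP F'P; rewrite /star_closed_fun (_ : mkset _ =
    [set x : option V -> K | exists y : bool -> K,
       [/\ y true = F (x \o Some), y false = F' (x \o Some) &
           x None = op (y true) (y false)]]); last first.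
  apply/seteqP; split=> x /= => [xop|[y [<- <-]] //].
  by exists (fun b => if b then F (x \o Some) else F' (x \o Some)).
apply: star_closed_rel_exists.
rewrite [X in star_closed_rel X](_ : _ =
    [set r : option V + bool -> K | r (inr true) = F (r \o (inl \o Some))] `&`
    [set r : option V + bool -> K | r (inr false) = F' (r \o (inl \o Some))] `&`
    [set r | r (inl None) = op (r (inr true)) (r (inr false))]).
  apply: star_closed_relI (star_closed_rel_op _ _ _ opP).
  by apply: star_closed_relI; exact: star_closed_rel_graph.
by apply/seteqP; split=> [r []//|r [[]]].
Qed.

Lemma star_closed_funD V (F F' : (V -> K) -> K) :
  star_closed_fun F -> star_closed_fun F' ->
  star_closed_fun (fun x => F x + F' x).
Proof. exact: star_closed_fun_op star_closed_op_add. Qed.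

Lemma star_closed_funM V (F F' : (V -> K) -> K) :
    star_closed_fun F -> star_closed_fun F' ->
  star_closed_fun (fun x => numul (F x) (F' x)).
Proof. exact: star_closed_fun_op star_closed_op_numul. Qed.

Lemma star_closed_fun_sum V (I : Type) (s : seq I) (F : I -> (V -> K) -> K) :
    (forall i, star_closed_fun (F i)) ->
  star_closed_fun (fun x => \sum_(i <- s) F i x).
Proof.
move=> FP; elim: s => [|i s IHs].
  under eq_fun do rewrite big_nil; exact: star_closed_fun0.
by under eq_fun do rewrite big_cons; apply: star_closed_funD.
Qed.

Lemma star_closed_rel_zeros V (F : (V -> K) -> K) :
  star_closed_fun F -> star_closed_rel [set x | F x = 0].
Proof.
move=> FP; rewrite (_ : mkset _ =
    [set x | exists z : unit -> K, z tt = F x /\ z tt = 0]).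
  apply: star_closed_rel_exists; apply: star_closed_relI.
    exact: (star_closed_rel_graph inl (inr tt) FP).
  exact: (@star_closed_rel_eq0 _ (inr tt)).
apply/seteqP; split=> x /=; first by exists (fun=> 0).
by move=> [z [<- ->]].
Qed.

Lemma star_closed_triples (I : finType) (M : set (I + I + I -> K)) :
    star_closed_rel M ->
  star_closed actY (diag3 (prod_act (fun=> aS)))
    [set (encode (r \o inl \o inl), encode (r \o inl \o inr),
          encode (r \o inr)) | r in M].
Proof.
pose ptsI := {ptws I -> S}.
pose glue12 (p : ptsI * ptsI * ptsI) : {ptws (I + I)%type -> S} * ptsI :=
  (case_sum p.1.1 p.1.2, p.2).
pose glue p : {ptws (I + I + I)%type -> S} :=
  case_sum (glue12 p).1 (glue12 p).2.
move=> MP.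
rewrite [X in star_closed _ _ X](_ : _ = glue @^-1` (@encode _ @` M)).
  apply: star_closed_preimage MP => [|g p]; last by apply/funext => -[[]|].
  have cglue12 : continuous glue12.
    apply: (continuous_map_pair (f' := id) (@case_sum_continuous I I S)) => t.
    exact: cvg_id.
  move=> p; have := @case_sum_continuous (I + I)%type I S (glue12 p).
  exact: (@continuous_comp _ _ _ glue12 _ p (cglue12 p)).
apply/seteqP; split=> [_ [r Mr <-]|[[s1 s2] s3] [r Mr rs]]; exists r => //.
  by apply/funext => -[[]|].
by congr (_, _, _); apply/funext => i; rewrite /encode /= -/(encode r _) rs.
Qed.

Lemma star_closed_group_in_encode (H : groupType) (I : finType)
    (c : H -> I -> K) (op : I -> (I + I -> K) -> K) :
    injective c -> star_closed_rel (range c) ->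
    (forall i, star_closed_fun (op i)) ->
    (forall h h' i, c (h * h')%g i = op i (case_sum (c h) (c h'))) ->
  star_closed_group_in actY (prod_act (fun=> aS)) (@encode I \o c).
Proof.
move=> c_inj c_range opP cM; split.
- exact: inj_comp (@encode_inj I) c_inj.
- by rewrite -(image_comp c (@encode I)).
pose M := [set r : I + I + I -> K | range c (r \o (inl \o inl))] `&`
  [set r : I + I + I -> K | range c (r \o (inl \o inr))] `&`
  [set r : I + I + I -> K | forall i, r (inr i) = op i (r \o inl)].
have /star_closed_triples : star_closed_rel M.
  apply: star_closed_relI.
    by apply: star_closed_relI; exact: star_closed_rel_reindex c_range.
  by apply: star_closed_rel_forall => i; exact: star_closed_rel_graph.
congr (star_closed _ _ _).
apply/seteqP; split=> [_ [r [[[h _ ch] [h' _ ch']] rM] <-]|_ [h [h' ->]]].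
  exists h, h'; rewrite /= ch ch'; congr (_, _, encode _); apply/funext => i.
  by rewrite cM ch ch' /= rM -[in LHS](case_sum_eta (r \o inl)).
exists (case_sum (case_sum (c h) (c h')) (c (h * h')%g)) => //.
by split=> [|i]; [split; [exists h|exists h']|exact: cM].
Qed.

Lemma star_closed_fun_circ_entry n (p : 'I_n * 'I_n) :
  star_closed_fun (circ_entry (K := K) p).
Proof.
apply: star_closed_funD.
  by apply: star_closed_funD; exact: star_closed_fun_proj.
apply: star_closed_fun_sum => k.
by apply: star_closed_funM; exact: star_closed_fun_proj.
Qed.

Lemma star_closed_circle_group n :
  star_closed_group_in actY (prod_act (fun=> aS))
    (fun g : circle_group (numatrix K n) => encode (mx_entries (val g))).
Proof.
apply: (star_closed_group_in_encode (op := @circ_entry K n)).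
- exact: inj_comp (can_inj (@mx_entriesK K n)) val_inj.
- rewrite range_circle_group_entries.
  apply: star_closed_rel_exists; apply: star_closed_rel_forall => p.
  by apply: star_closed_relI; apply: star_closed_rel_zeros;
    apply: star_closed_fun_case_sum; exact: star_closed_fun_circ_entry.
- exact: star_closed_fun_circ_entry.
- by move=> g h p; rewrite circ_entryE.
Qed.

Lemma star_closed_heisenberg :
  star_closed_group_in actY (prod_act (fun=> aS))
    (fun h : heisenberg K => encode (heis_coords h)).
Proof.
apply: (star_closed_group_in_encode (op := @heis_coord_mul K)).
- exact: (@heis_coords_inj K).
- by rewrite range_heis_coords; exact: star_closed_relT.
- move=> i; apply: star_closed_funD.
    by apply: star_closed_funD; exact: star_closed_fun_proj.
  case: (i == ord_max); last exact: star_closed_fun0.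
  by apply: star_closed_funM; exact: star_closed_fun_proj.
- move=> h h' i; rewrite heis_mulE /heis_coord_mul /heis_coords /=.
  by case: i => -[|[|[]]] //= _; rewrite addr0.
Qed.

End StarClosedRing.

(** * Finite powers of finite products *)

Section ReindexProduct.
Variables (L : eqType) (J : eqType) (T : L -> topologicalType).
Variables (e : J -> L) (e' : L -> J) (eK : cancel e e') (e'K : cancel e' e).

Definition reindex_prod (x : prod_topology (T \o e)) : prod_topology T :=
  fun l => ecast i (T i) (e'K l) (x (e' l)).

Lemma reindex_prodE x j : reindex_prod x (e j) = x j.
Proof.
rewrite /reindex_prod; move: (e'K (e j)); rewrite eK => ej.
by rewrite (eq_irrelevance ej erefl).
Qed.

Lemma reindex_prod_comp (y : prod_topology T) :
  reindex_prod (fun j => y (e j)) = y.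
Proof.
apply: functional_extensionality_dep => l; rewrite /reindex_prod.
by move: (e' l) (e'K l) => j; case: l /.
Qed.

Lemma reindex_prod_act (G : topGroupType) (a : forall l, G -> T l -> T l) g x :
  reindex_prod (prod_act (fun j => a (e j)) g x) =
  prod_act a g (reindex_prod x).
Proof.
apply: functional_extensionality_dep => l.
by rewrite /reindex_prod /prod_act; move: (e' l) (e'K l) => j; case: l /.
Qed.

Lemma reindex_prod_continuous l : continuous (fun x => reindex_prod x l).
Proof.
rewrite /reindex_prod.
by move: (e' l) (e'K l) => j; case: l /; exact: proj_continuous.
Qed.

End ReindexProduct.

Section PowerOfProduct.
Variables (I L : finType) (T : L -> topologicalType).

Definition pow_coord (j : 'I_#|{: I * L}|) : L := (enum_val j).2.

Definition flatten_pow (f : {ptws I -> prod_topology T})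
    : prod_topology (T \o pow_coord) :=
  fun j => f (enum_val j).1 (enum_val j).2.

Definition unflatten_pow (x : prod_topology (T \o pow_coord))
    : {ptws I -> prod_topology T} :=
  fun i l => reindex_prod (T := fun p : I * L => T p.2) enum_rankK x (i, l).

Lemma flatten_powK : cancel flatten_pow unflatten_pow.
Proof.
move=> f; apply/funext => i; apply: functional_extensionality_dep => l.
exact: (congr1 (@^~ (i, l)) (reindex_prod_comp _ (fun p => f p.1 p.2))).
Qed.

Lemma unflatten_powK : cancel unflatten_pow flatten_pow.
Proof.
move=> x; apply: functional_extensionality_dep => j.
pose r := reindex_prod (T := fun p : I * L => T p.2) enum_rankK x.
have pair_eta p : r (p.1, p.2) = r p :> T p.2 by case: p.
exact: etrans (pair_eta (enum_val j)) (reindex_prodE enum_valK enum_rankK x j).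
Qed.

Lemma unflatten_pow_continuous : continuous unflatten_pow.
Proof.
apply: continuous_into_prod => i; apply: continuous_into_prod => l.
pose Tsnd (p : I * L) := T p.2.
exact: (@reindex_prod_continuous _ _ Tsnd _ _ enum_rankK (i, l)).
Qed.

Lemma star_closed_group_in_flatten (G : topGroupType) (Y : Type)
    (actY : G -> Y -> Y) (a : forall l, G -> T l -> T l) (H : groupType)
    (v : H -> {ptws I -> prod_topology T}) :
  star_closed_group_in actY (prod_act (fun=> prod_act a)) v ->
  star_closed_group_in actY (prod_act (fun j => a (pow_coord j)))
    (flatten_pow \o v).
Proof.
apply: (star_closed_group_in_bijection flatten_powK unflatten_powK).
  exact: unflatten_pow_continuous.
move=> g x; apply/funext => i; apply: functional_extensionality_dep => l.
exact: (congr1 (@^~ (i, l)) (reindex_prod_act _ (fun p : I * L => a p.2) g x)).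
Qed.

End PowerOfProduct.

Section CompactSorts.
Variables (X : topologicalType) (G : topGroupType) (act : G -> X -> X).
Hypothesis cX : compact [set: X].

Lemma pow_space_compact n : compact [set: pow_space X n].
Proof. exact: prod_topology_compact. Qed.

Lemma sort_space_compact (s : teq_sort act) : compact [set: sort_space s].
Proof.
pose p := \pi_(sort_space s)%qT : pow_space X (sort_arity s) -> sort_space s.
rewrite (_ : setT = p @` setT).
  apply: continuous_compact; last exact: pow_space_compact.
  by apply: continuous_subspaceT; exact: pi_continuous.
by apply/seteqP; split=> // x _; exists (repr x) => //; apply: reprK.
Qed.

Lemma sort_prod_compact k (s : 'I_k -> teq_sort act) :
  compact [set: sort_prod s].
Proof. by apply: prod_topology_compact => i; exact: sort_space_compact. Qed.

End CompactSorts.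

Section PowersOfSorts.
Variables (X : topologicalType) (G : topGroupType) (act : G -> X -> X).
Variables (H : groupType) (I : finType).

Lemma star_closed_group_pow n (v : H -> {ptws I -> pow_space X n}) :
  star_closed_group_in act (prod_act (fun=> @pow_act G X act n)) v ->
  star_closed_group act H.
Proof.
move=> vP; exists #|{: I * 'I_n}|; eexists.
exact: (star_closed_group_in_flatten (a := fun=> act) vP).
Qed.

Lemma teq_star_closed_group_pow k (s : 'I_k -> teq_sort act)
    (v : H -> {ptws I -> sort_prod s}) :
  star_closed_group_in (@teq_act G X act)
    (prod_act (fun=> @sort_prod_act G X act k s)) v ->
  teq_star_closed_group act H.
Proof.
move=> vP; exists #|{: I * 'I_k}|, (s \o @pow_coord I _); eexists.
pose sort_acts i := @sort_act G X act (s i).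
exact: (star_closed_group_in_flatten (a := sort_acts) vP).
Qed.

End PowersOfSorts.

Theorem theorem3p3 (R : realType) (X : topologicalType) (G : topGroupType)
    (act : G -> X -> X) (XG : compact_G_space R act) :
  (((forall H : groupType, star_closed_group act H -> solvable_by_finite H) ->
    forall K : nonUnitalRingType, star_closed_ring act K ->
      has_identity K \/ finite_characteristic K -> nilpotent_by_finite K)
   /\
   ((forall H : groupType, teq_star_closed_group act H ->
       solvable_by_finite H) ->
    forall K : nonUnitalRingType, teq_star_closed_ring act K ->
      has_identity K \/ finite_characteristic K -> nilpotent_by_finite K))
  /\
  (((forall H : groupType, star_closed_group act H -> nilpotent_group H ->
       abelian_by_finite H) ->
    forall K : nonUnitalRingType, star_closed_ring act K -> null_by_finite K)
   /\
   ((forall H : groupType, teq_star_closed_group act H -> nilpotent_group H ->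
       abelian_by_finite H) ->
    forall K : nonUnitalRingType, teq_star_closed_ring act K ->
      null_by_finite K)).
Proof.
have cX := cgs_compact XG.
split; split=> grpP K.
- move=> [n [u uP]] _.
  apply: (@circle_group_nilpotent_by_finite K 0); apply: grpP.
  have cXn := @pow_space_compact X cX n.
  exact: star_closed_group_pow (star_closed_circle_group cXn uP 3).
- move=> [k [s [u uP]]] _.
  apply: (@circle_group_nilpotent_by_finite K 0); apply: grpP.
  have cXs := @sort_prod_compact X G act cX k s.
  exact: teq_star_closed_group_pow (star_closed_circle_group cXs uP 3).
- move=> [n [u uP]]; apply: heisenberg_null_by_finite.
  apply: grpP (heisenberg_nilpotent K).
  have cXn := @pow_space_compact X cX n.
  exact: star_closed_group_pow (star_closed_heisenberg cXn uP).
- move=> [k [s [u uP]]]; apply: heisenberg_null_by_finite.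
  apply: grpP (heisenberg_nilpotent K).
  have cXs := @sort_prod_compact X G act cX k s.
  exact: teq_star_closed_group_pow (star_closed_heisenberg cXs uP).
Qed.
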